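(* Fix an integer $d\ge 0$ and $p\in(0,1)$. For each $m$, let $\mathcal{C}_m$ be the random purely $d$-dimensional complex on $[m]=\{1,\ldots,m\}$ drawn from $\mathcal{PD}_{m,p}$. Then the probability that all roots of $\mathrm{Rel}(\mathcal{C}_m;q)$ lie in the closed unit disk $\{z\in\mathbb{C}:|z|\le1\}$ tends to $1$ as $m\to\infty$.
   Context: A (simplicial) complex on a nonempty finite set $X$ is a collection of subsets of $X$ (faces) closed under taking subsets; maximal faces are facets; it is purely $d$-dimensional if all facets have cardinality exactly $d$. The reliability polynomial is $\mathrm{Rel}(\mathcal{C};q)=\sum_{\sigma\in\mathcal{C}} q^{|\sigma|}(1-q)^{|X\setminus\sigma|}$. The random model $\mathcal{PD}_{m,p}$: each $d$-element subset of $[m]$ is chosen independently with probability $p$, and the complex is the collection of all subsets of the chosen $d$-subsets (so the chosen $d$-subsets are exactly the facets).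
   Formalization: The zero polynomial (the outcome where no d-subset is chosen) is counted as having no roots; otherwise the claim fails for d = 0, where that outcome has probability 1-p for every m. For d ≥ 1 its probability tends to 0, so nothing changes. *)

(* Defs.v *)
From HB Require Import structures.
From mathcomp Require Import all_boot all_order all_algebra.
From mathcomp Require Import complex.
From mathcomp Require Import all_classical all_reals all_analysis.
Set Implicit Arguments.
Unset Strict Implicit.
Unset Printing Implicit Defensive.
Import Order.TTheory GRing.Theory Num.Theory.
Import numFieldNormedType.Exports.
Local Open Scope ring_scope.

Definition is_complex (X : finType) (C : {set {set X}}) : Prop :=
  forall s t : {set X}, t \in C -> s \subset t -> s \in C.

Definition facets (X : finType) (C : {set {set X}}) : {set {set X}} :=
  [set s in C | [forall t in C, (s \subset t) ==> (t == s)]].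

(* The dimension of a face is its cardinality here, not its cardinality
   minus one. *)
Definition purely_dimensional (X : finType) (d : nat) (C : {set {set X}}) :
    Prop :=
  is_complex C /\ forall s : {set X}, s \in facets C -> #|s| = d.

Definition reliability_poly (K : nzRingType) (X : finType)
    (C : {set {set X}}) : {poly K} :=
  \sum_(s in C) 'X^#|s| * (1 - 'X) ^+ #|~: s|.

Definition generated_complex (X : finType) (S : {set {set X}}) :
    {set {set X}} :=
  [set t : {set X} | [exists s in S, t \subset s]].

Definition dsubsets (X : finType) (d : nat) : {set {set X}} :=
  [set s : {set X} | #|s| == d].

Lemma generated_complex_is_complex (X : finType) (S : {set {set X}}) :
  is_complex (generated_complex S).
Proof.
move=> s t; rewrite !inE => /existsP[u /andP[uS tu]] st.
by apply/existsP; exists u; rewrite uS (fintype.subset_trans st tu).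
Qed.

Lemma facets_generated_complex (X : finType) (d : nat) (S : {set {set X}}) :
  S \subset dsubsets X d -> facets (generated_complex S) = S.
Proof.
move=> /fintype.subsetP Sd; apply/setP => s; rewrite !inE; apply/andP/idP.
  case=> /existsP[u /andP[uS su]] /forallP/(_ u).
  rewrite inE su /=; have -> : [exists v in S, u \subset v].
    by apply/existsP; exists u; rewrite uS /=.
  by move=> /eqP <-.
move=> sS; split; first by apply/existsP; exists s; rewrite sS /=.
apply/forallP => t; apply/implyP; rewrite inE => /existsP[u /andP[uS tu]].
apply/implyP => st; rewrite eq_sym eqEcard st /=.
have := Sd _ sS; have := Sd _ uS; rewrite !inE => /eqP cu /eqP cs.
by rewrite cs -cu subset_leq_card.
Qed.

Lemma generated_complex_pure (X : finType) (d : nat) (S : {set {set X}}) :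
  S \subset dsubsets X d -> purely_dimensional d (generated_complex S).
Proof.
move=> Sd; split; first exact: generated_complex_is_complex.
move=> s; rewrite (facets_generated_complex Sd) => sS.
by have /fintype.subsetP/(_ _ sS) := Sd; rewrite inE => /eqP.
Qed.

(* Probability of the outcome "S is the set of chosen d-subsets of [m]"; the
   choices being independent, it is a product over all d-subsets. *)
Definition pd_weight (R : realType) (m d : nat) (p : R)
    (S : {set {set 'I_m}}) : R :=
  \prod_(s in dsubsets 'I_m d) (if s \in S then p else 1 - p).

(* E is an event about the random complex (not about the set of facets). *)
Definition pd_prob (R : realType) (m d : nat) (p : R)
    (E : {set {set 'I_m}} -> Prop) : R :=
  \sum_(S in powerset (dsubsets 'I_m d) | `[< E (generated_complex S) >])
    pd_weight d p S.

Lemma pd_prob_contains (R : realType) (m d : nat) (p : R)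
    (A : {set {set 'I_m}}) : A \subset dsubsets 'I_m d ->
  pd_prob d p (fun C => A \subset facets C) = p ^+ #|A|.
Proof.
move=> Ad; pose D := dsubsets 'I_m d.
pose F (s : {set 'I_m}) : R := if s \in D then p else 0.
pose G (s : {set 'I_m}) : R :=
  if s \in D then if s \in A then 0 else 1 - p else 1.
have -> : p ^+ #|A| = \prod_s (F s + G s).
  rewrite -prodr_const big_mkcond /=; apply: eq_bigr => s _.
  rewrite /F /G; case: ifPn => sA.
    by rewrite (fintype.subsetP Ad _ sA) addr0.
  by case: ifP => _; rewrite ?add0r // addrC subrK.
rewrite bigA_distr /pd_prob big_mkcond /=; apply: eq_bigr => S _.
rewrite powersetE; case: ifPn => [/andP[SD /asboolP]|].
  rewrite (facets_generated_complex SD) => /fintype.subsetP AS.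
  rewrite /pd_weight big_mkcond; apply: eq_bigr => s _ /=.
  rewrite /F /G /D; case: (boolP (s \in S)) => [sS|sS].
    by rewrite (fintype.subsetP SD _ sS).
  by case: ifP => // _; case: ifPn => // /AS; rewrite (negbTE sS).
rewrite negb_and => nS; apply/esym/eqP; rewrite prodf_seq_eq0; apply/hasP.
case: (boolP (S \subset D)) nS => [SD /= /asboolP|/fintype.subsetPn[s sS sD] _].
  rewrite (facets_generated_complex SD) => /negP/fintype.subsetPn[s sA sS].
  exists s; rewrite ?mem_index_enum //= (negbTE sS) /G sA.
  by rewrite (fintype.subsetP Ad _ sA).
by exists s; rewrite ?mem_index_enum //= sS /F (negbTE sD).
Qed.

Lemma pd_prob_total (R : realType) (m d : nat) (p : R) :
  @pd_prob R m d p (fun=> True) = 1.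
Proof.
rewrite -(expr0 p) -(@cards0 {set 'I_m}).
rewrite -(pd_prob_contains p (finset.sub0set (dsubsets 'I_m d))).
by apply: eq_bigl => S; congr andb; apply/asboolP/asboolP => // _; exact: finset.sub0set.
Qed.

(* The zero polynomial is taken to have no roots.  It is the reliability
   polynomial of the empty collection of faces, i.e. of the outcome in which no
   d-subset is chosen; for d = 0 that outcome has probability 1 - p for all m.
   *)
Definition roots_in_unit_disk (R : realType) (P : {poly R[i]}) : Prop :=
  P != 0 -> forall z : R[i], root P z -> `|z| <= 1.

(* Main.v *)
(** Write [F_i] for the number of faces of cardinality [i].  For [|z| > 1] put
    [w = (1 - z) / z], so that [|w| < 2] and
    [Rel(C; z) = z^d (1 - z)^(m - d) \sum_i F_i w^(d - i)].  The term [i = d]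
    dominates as soon as [F_d > \sum_(i < d) 2^(d - i) F_i], and the right-hand
    side is at most [K m^(d - 1)] for a constant [K].  Since [F_d] is binomial
    with parameters ['C(m, d)] (of order [m^d]) and [p], a Chernoff bound gives
    [P(F_d <= k) <= 2^k (1 - p / 2)^'C(m, d)], which tends to [0] for
    [k = K m^(d - 1)]. *)
Require Import Defs.
From HB Require Import structures.
From mathcomp Require Import all_boot all_order all_algebra.
From mathcomp Require Import complex.
From mathcomp Require Import all_classical all_reals all_analysis.
From mathcomp Require Import ring lra zify.
Import Order.TTheory GRing.Theory Num.Theory.
Import numFieldNormedType.Exports.
Local Open Scope ring_scope.

(** * Deterministic criterion: dominance of the top faces *)

Lemma horner_reliability_poly (K : comNzRingType) (X : finType)
    (C : {set {set X}}) (z : K) :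
  (reliability_poly K C).[z] = \sum_(s in C) z ^+ #|s| * (1 - z) ^+ #|~: s|.
Proof.
rewrite /reliability_poly horner_sum; apply: eq_bigr => s _.
by rewrite hornerM !horner_exp !hornerE.
Qed.

Lemma roots_in_unit_disk_dominant_top (R : realType) (X : finType) (d : nat)
    (C : {set {set X}}) :
  (forall s, s \in C -> (#|s| <= d)%N) ->
  (\sum_(s in C | (#|s| < d)%N) 2 ^ (d - #|s|) < #|[set s in C | #|s| == d]|)%N ->
  roots_in_unit_disk (reliability_poly R[i] C).
Proof.
move=> Cd dom _ z; rewrite /root horner_reliability_poly => /eqP rz.
rewrite real_leNgt ?normr_real ?real1 //; apply/negP => z1.
have zn0 : `|z| != 0 by rewrite gt_eqF // (lt_trans ltr01 z1).
have z0 : z != 0 by rewrite -normr_eq0.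
have z1n : 1 - z != 0.
  by rewrite subr_eq0; apply: contraTneq z1 => <-; rewrite normr1 ltxx.
pose w := (1 - z) / z.
(* [|1 - z| <= 1 + |z| <= 2 |z|]. This weak bound suffices because the dominance hypothesis is
   strict. *)
have w2 : `|w| <= 2.
  rewrite normrM normfV ler_pdivrMr ?(lt_trans ltr01 z1) //.
  apply: (le_trans (ler_normB _ _)); rewrite normr1 mulr_natl mulr2n.
  by rewrite lerD2r ltW.
(* Strict dominance forces a face of cardinality [d] to exist, so the subtraction [#|X| - d] below
   is not truncated. *)
have dX : (d <= #|X|)%N.
  have /card_gt0P[s] : (0 < #|[set s in C | #|s| == d]|)%N.
    exact: leq_ltn_trans dom.
  by rewrite inE => /andP[_ /eqP <-]; exact: max_card.
have sw : \sum_(s in C) w ^+ (d - #|s|) = 0.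
  apply: (mulfI (_ : z ^+ d * (1 - z) ^+ (#|X| - d) != 0)).
    by rewrite mulf_neq0 // expf_neq0.
  rewrite mulr0 -[RHS]rz mulr_sumr; apply: eq_bigr => s sC.
  have sd := Cd _ sC; rewrite [#|~: s|]cardsCs finset.setCK.
  have -> : (#|X| - #|s| = (#|X| - d) + (d - #|s|))%N by lia.
  have {1}-> : d = (#|s| + (d - #|s|))%N by lia.
  rewrite /w expr_div_n !exprD; field.
  by rewrite expf_neq0.
move: sw; rewrite (bigID (fun s : {set X} => (#|s| < d)%N)) /=.
set A := (X in X + _); set B := (X in _ + X).
have -> : B = #|[set s in C | #|s| == d]|%:R.
  rewrite -sum1_card natr_sum /B; apply: eq_big => [s|s].
    rewrite inE; case: (boolP (s \in C)) => //= /Cd sd.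
    by rewrite -leqNgt eqn_leq sd.
  by case/andP => sC; rewrite -leqNgt -subn_eq0 => /eqP ->.
move=> /eqP; rewrite addr_eq0 => /eqP AB.
have : `|A| <= (\sum_(s in C | (#|s| < d)%N) 2 ^ (d - #|s|))%:R.
  rewrite natr_sum; apply: (le_trans (ler_norm_sum _ _ _)).
  by apply: ler_sum => s _; rewrite normrX natrX lerXn2r ?nnegrE.
by rewrite AB normrN normr_nat ler_nat leqNgt dom.
Qed.

(** * Binomial estimates and counts of small subsets *)

Lemma bin_leq_exp (m i : nat) : ('C(m, i) <= m ^ i)%N.
Proof.
apply: (@leq_trans (m ^_ i)); first by rewrite -bin_ffact leq_pmulr ?fact_gt0.
rewrite ffact_prod -[X in (_ <= m ^ X)%N]card_ord -prod_nat_const.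
by apply: leq_prod => j _; exact: leq_subr.
Qed.

(** Each factor [m - j], [j < d], of the falling factorial is at least [m / 2]. *)
Lemma exp_leq_bin (m d : nat) : (d.*2 <= m)%N ->
  (m ^ d <= 'C(m, d) * (d`! * 2 ^ d))%N.
Proof.
move=> dm; rewrite mulnA bin_ffact ffact_prod -[X in (m ^ X)%N]card_ord.
rewrite -[X in (_ * 2 ^ X)%N]card_ord -!prod_nat_const -big_split /=.
by apply: leq_prod => j _; have := ltn_ord j; lia.
Qed.

Lemma card_small_subsets (X : finType) (e : nat) : (0 < #|X|)%N ->
  (#|[set s : {set X} | #|s| < e.+1]| <= e.+1 * #|X| ^ e)%N.
Proof.
move=> X0; rewrite -sum1_card; under eq_bigl do rewrite inE.
(* Group the subsets by cardinality [i <= e]: each of the [e.+1] classes has at most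
   [#|X| ^ i <= #|X| ^ e] members. *)
rewrite (partition_big (fun s : {set X} => inord #|s| : 'I_e.+1) xpredT) //=.
rewrite -[X in (X * _)%N]card_ord -sum_nat_const; apply: leq_sum => i _.
apply: (@leq_trans 'C(#|X|, i)); last first.
  by rewrite (leq_trans (bin_leq_exp _ _)) // leq_pexp2l // -ltnS.
rewrite -card_draws sum1_card; apply/subset_leq_card/fintype.subsetP => s.
by rewrite !inE => /andP[se /eqP <-]; rewrite inordK.
Qed.

Lemma generated_complex_sup (X : finType) (S : {set {set X}}) :
  S \subset generated_complex S.
Proof.
by apply/fintype.subsetP => s sS; rewrite inE; apply/existsP; exists s; rewrite sS /=.
Qed.

Lemma generated_complex_card (X : finType) (d : nat) (S : {set {set X}}) :
  S \subset dsubsets X d ->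
  forall s, s \in generated_complex S -> (#|s| <= d)%N.
Proof.
move=> /fintype.subsetP Sd s; rewrite inE => /existsP[t /andP[/Sd]].
by rewrite inE => /eqP <-; exact: subset_leq_card.
Qed.

(** Makes the criterion depend on [#|S|] alone: each lower face has weight at most [2 ^ e.+1], and
    lower faces are at most as many as all subsets of cardinality at most [e]. *)
Lemma roots_in_unit_disk_many_facets (R : realType) (X : finType) (e : nat)
    (S : {set {set X}}) :
  (0 < #|X|)%N -> S \subset dsubsets X e.+1 ->
  (2 ^ e.+1 * e.+1 * #|X| ^ e < #|S|)%N ->
  roots_in_unit_disk (reliability_poly R[i] (generated_complex S)).
Proof.
move=> X0 Sd big; apply: (@roots_in_unit_disk_dominant_top _ _ e.+1).
  exact: generated_complex_card.
apply: (@leq_ltn_trans (2 ^ e.+1 * e.+1 * #|X| ^ e)); last first.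
  apply: (leq_trans big); apply/subset_leq_card/fintype.subsetP => s sS.
  rewrite inE (fintype.subsetP (generated_complex_sup _ S)) //=.
  by have := fintype.subsetP Sd _ sS; rewrite inE.
apply: (@leq_trans (\sum_(s : {set X} | (#|s| < e.+1)%N) 2 ^ e.+1)).
  rewrite big_mkcond [X in (_ <= X)%N]big_mkcond; apply: leq_sum => s _.
  case: (s \in _) => //=; case: ifP => // _.
  by rewrite leq_pexp2l // leq_subr.
rewrite sum_nat_const mulnC -mulnA leq_mul //.
apply: leq_trans (card_small_subsets _ _ X0).
by apply: subset_leq_card; apply/fintype.subsetP => s; rewrite inE.
Qed.

Lemma roots_in_unit_disk_dim0 (R : realType) (X : finType)
    (S : {set {set X}}) : S \subset dsubsets X 0 ->
  roots_in_unit_disk (reliability_poly R[i] (generated_complex S)).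
Proof.
move=> Sd; have [->|/set0Pn[t tS]] := eqVneq S finset.set0.
  have -> : generated_complex finset.set0 = finset.set0 :> {set {set X}}.
    by apply/setP => s; rewrite !inE; apply/existsP => -[t]; rewrite inE.
  (* The empty complex gives the zero polynomial, which has no roots by convention. *)
  by rewrite /reliability_poly big_set0 => /eqP.
apply: (@roots_in_unit_disk_dominant_top _ _ 0).
  exact: generated_complex_card.
rewrite big_pred0 => [|s]; last by rewrite ltn0 andbF.
apply/card_gt0P; exists t; rewrite inE.
rewrite (fintype.subsetP (generated_complex_sup _ S)) //=.
by have := fintype.subsetP Sd _ tS; rewrite inE.
Qed.

(** * Binomial tail of the number of chosen subsets *)

Lemma sum_powerset_prod (K : comNzRingType) (T : finType) (D : {set T})
    (a b : K) :
  \sum_(S in powerset D) \prod_(s in D) (if s \in S then a else b)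
  = (a + b) ^+ #|D|.
Proof.
(* Outside [D] the factors are 0 and 1, so expanding the product over the whole type leaves only the
   terms with [S \subset D]. *)
pose F s : K := if s \in D then a else 0.
pose G s : K := if s \in D then b else 1.
have -> : (a + b) ^+ #|D| = \prod_s (F s + G s).
  rewrite -prodr_const big_mkcond /=; apply: eq_bigr => s _.
  by rewrite /F /G; case: ifP => _; rewrite ?add0r.
rewrite bigA_distr big_mkcond; apply: eq_bigr => S _; rewrite powersetE.
case: ifPn => [SD|/fintype.subsetPn[s sS sD]].
  rewrite big_mkcond; apply: eq_bigr => s _; rewrite /F /G.
  by case: ifPn => // sD; case: ifP => // /(fintype.subsetP SD); rewrite (negbTE sD).
by rewrite (bigD1 s) //= sS /F (negbTE sD) mul0r.
Qed.

Lemma pd_weight_ge0 (R : realType) (m d : nat) (p : R)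
    (S : {set {set 'I_m}}) : 0 < p < 1 ->
  0 <= pd_weight d p S.
Proof.
by move=> /andP[p0 p1]; apply: prodr_ge0 => s _; case: ifP => _; lra.
Qed.

Lemma pd_probC (R : realType) (m d : nat) (p : R)
    (E : {set {set 'I_m}} -> Prop) :
  pd_prob d p E = 1 - pd_prob d p (fun C => ~ E C).
Proof.
apply: (canRL (addrK _)); rewrite -(@pd_prob_total R m d p) /pd_prob.
rewrite [RHS](bigID (fun S => `[< E (generated_complex S) >])) /=.
by congr (_ + _); apply: eq_bigl => S; rewrite (asboolT I) andbT // asbool_neg.
Qed.

Lemma pd_prob_ge0 (R : realType) (m d : nat) (p : R)
    (E : {set {set 'I_m}} -> Prop) : 0 < p < 1 -> 0 <= pd_prob d p E.
Proof. by move=> hp; apply: sumr_ge0 => S _; exact: pd_weight_ge0. Qed.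

(* Markov's inequality for [2 ^- #|S|]. *)
Lemma pd_weight_chernoff (R : realType) (m d : nat) (p : R) (k : nat) :
  0 < p < 1 ->
  \sum_(S in powerset (dsubsets 'I_m d) | (#|S| <= k)%N) pd_weight d p S
  <= 2 ^+ k * (1 - p / 2) ^+ 'C(m, d).
Proof.
move=> hp; have -> : 'C(m, d) = #|dsubsets 'I_m d| by rewrite card_draws card_ord.
(* Each potential facet contributes the mean of [2^-1] (if chosen, probability [p]) and [1]
   (otherwise), so the expectation of [2 ^- #|S|] is a power of this sum. *)
have -> : 1 - p / 2 = p / 2 + (1 - p) by lra.
rewrite -sum_powerset_prod mulr_sumr big_mkcondr; apply: ler_sum => S.
rewrite powersetE => SD.
have -> : \prod_(s in dsubsets 'I_m d) (if s \in S then p / 2 else 1 - p)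
    = pd_weight d p S / 2 ^+ #|S|.
  have -> : 2 ^- #|S| = \prod_(s in dsubsets 'I_m d) (if s \in S then 2^-1 else 1) :> R.
    rewrite -exprVn -prodr_const -big_mkcondr; apply: eq_bigl => s.
    by case: (boolP (s \in S)) => [/(fintype.subsetP SD) ->|]; rewrite ?andbF.
  by rewrite -big_split; apply: eq_bigr => s _; case: ifP => _ //=; rewrite mulr1.
rewrite mulrCA; case: ifP => [Sk|_]; last first.
  by rewrite mulr_ge0 ?pd_weight_ge0 // divr_ge0 // exprn_ge0.
rewrite ler_peMr ?pd_weight_ge0 // ler_pdivlMr ?exprn_gt0 // mul1r.
by rewrite ler_eXn2l ?ltr1n.
Qed.

(** * Passage to the limit *)

Local Open Scope classical_set_scope.

Lemma divn_cvgny (A : nat) : (0 < A)%N -> (fun m => m %/ A)%N @ \oo --> \oo.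
Proof.
move=> A0 P [N _ NP]; exists (N * A)%N => //= n /= h.
by apply: NP; rewrite /= leq_divRL.
Qed.

(** The Chernoff bound at [k = K * m ^ e] is at most [u ^+ (m ^ e)], as ['C(m, e.+1)] is at least
    [m ^ e] times a linear function of [m]. Since [u <= 1], this power is at most [u], which is
    easier to send to 0. *)
Lemma pd_prob_root_outside_le (R : realType) (m e : nat) (p : R) (hp : 0 < p < 1) :
  let K := (2 ^ e.+1 * e.+1)%N in
  let u : R := 2 ^+ K * (1 - p / 2) ^+ (m %/ (e.+1`! * 2 ^ e.+1)) in
  (e.+1.*2 <= m)%N -> u <= 1 ->
  @pd_prob R m e.+1 p (fun C : {set {set 'I_m}} =>
     ~ roots_in_unit_disk (reliability_poly R[i] C)) <= u.
Proof.
move=> K u em u1; have /andP[p0 p1] := hp; have m0 : (0 < m)%N by exact: leq_trans em.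
have u0 : 0 <= u by rewrite mulr_ge0 // exprn_ge0 //; lra.
apply: (@le_trans _ _ (u ^+ (m ^ e))); last first.
  by rewrite ler_iXnr // ?expn_gt0 ?m0.
apply: (@le_trans _ _ (2 ^+ (K * m ^ e) * (1 - p / 2) ^+ 'C(m, e.+1))); last first.
  rewrite /u exprMn -!exprM ler_wpM2l ?exprn_ge0 //.
  (* It remains that [m ^ e * (m %/ A) <= 'C(m, e.+1)] for [A := e.+1`! * 2 ^ e.+1]. *)
  apply: ler_wiXn2l; [lra|lra|].
  rewrite -(@leq_pmul2r (e.+1`! * 2 ^ e.+1)) ?muln_gt0 ?fact_gt0 ?expn_gt0 //.
  apply: leq_trans (exp_leq_bin _ _ em).
  by rewrite mulnAC [(m ^ e.+1)%N]expnS leq_mul2r leq_divM orbT.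
apply: le_trans (pd_weight_chernoff _ _ _ _ _ hp).
rewrite /pd_prob big_mkcondr [leRHS]big_mkcondr; apply: ler_sum => S.
rewrite powersetE => SD; case: asboolP => [nE|_]; last first.
  by case: ifP => // _; exact: pd_weight_ge0.
(* An outcome with a root outside the disk has at most [K * m ^ e] facets. *)
case: leqP => // big; exfalso; apply: nE.
by apply: (@roots_in_unit_disk_many_facets _ _ e); rewrite ?card_ord.
Qed.

Theorem theorem7 (R : realType) (d : nat) (p : R) (hp : 0 < p < 1) :
  (fun m : nat => @pd_prob R m d p (fun C : {set {set 'I_m}} =>
     roots_in_unit_disk (reliability_poly R[i] C))) @ \oo --> (1 : R).
Proof.
(* The estimate uses [m ^ (d - 1)], so [d = 0] is separate: there every outcome is good and the
   probability is constantly 1. *)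
have /andP[p0 p1] := hp; case: d => [|e].
  rewrite (_ : (fun m => _) = fun=> 1); first exact: cvg_cst.
  apply/funext => m; rewrite -(@pd_prob_total R m 0 p); apply: eq_bigl => S.
  rewrite powersetE; case: (boolP (S \subset _)) => //= S0.
  by rewrite !asboolT //; exact: roots_in_unit_disk_dim0.
pose u (m : nat) : R := 2 ^+ (2 ^ e.+1 * e.+1)
  * (1 - p / 2) ^+ (m %/ (e.+1`! * 2 ^ e.+1)).
have u0 : u @ \oo --> (0 : R).
  (* [u] is a geometric sequence of ratio [1 - p / 2 < 1] taken along [m %/ A], with [A] a positive
     constant. *)
  pose v : nat -> R := geometric (2 ^+ (2 ^ e.+1 * e.+1)) (1 - p / 2).
  apply: (@cvg_comp _ _ _ (fun m => m %/ (e.+1`! * 2 ^ e.+1))%N v _ \oo).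
    by apply: divn_cvgny; rewrite muln_gt0 fact_gt0 expn_gt0.
  by apply: cvg_geometric; rewrite ger0_norm; lra.
have u1 : \forall m \near \oo, u m <= 1.
  by apply: (cvgr_le _ u0); exact: ltr01.
apply: (@squeeze_cvgr _ _ _ _ (fun m => 1 - u m) (fun=> 1)).
- near=> m; rewrite pd_probC gerBl pd_prob_ge0 // lerD2l lerN2 andbT.
  by apply: pd_prob_root_outside_le => //; near: m; [exact: nbhs_infty_ge|].
- by rewrite -[X in _ --> X]subr0; apply: cvgB => //; exact: cvg_cst.
- exact: cvg_cst.
Unshelve. all: by end_near.
Qed.
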